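(* Let $Z\sim N(0,1)$. For each integer $n\ge1$ let $X_1(n)$ be the number of tosses of a fair coin until reaching, for the first time, $n$ Heads or $n$ Tails, and let $X_2(n)$ be the number of tosses until reaching, for the first time, both $n$ Heads and $n$ Tails. Then all moments, both ordinary and absolute, converge as $n\to\infty$ in each of the following four limits in distribution: $$\frac{X_1(n)-2n}{\sqrt n}\to -\sqrt2\,|Z|,\qquad \frac{X_1(n)-\mathbb E[X_1(n)]}{\sqrt n}\to -\sqrt2\,(|Z|-\mathbb E|Z|),$$ $$\frac{X_2(n)-2n}{\sqrt n}\to \sqrt2\,|Z|,\qquad \frac{X_2(n)-\mathbb E[X_2(n)]}{\sqrt n}\to \sqrt2\,(|Z|-\mathbb E|Z|).$$ That is, writing any one of these four as $Y_n\to Y$, one has $\mathbb E[Y_n^k]\to\mathbb E[Y^k]$ for every integer $k\ge1$ and $\mathbb E[|Y_n|^r]\to\mathbb E[|Y|^r]$ for every real $r>0$.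
   Context: Tosses are independent, each giving Heads or Tails with probability $1/2$. Let $H_N$ and $T_N$ be the number of Heads and Tails, respectively, among the first $N$ tosses. Then $X_1(n)=\min\{N: H_N=n \text{ or } T_N=n\}$ and $X_2(n)=\min\{N: H_N\ge n \text{ and } T_N\ge n\}$ (the latter is almost surely finite). *)

(* Defs.v *)
From mathcomp Require Export all_boot all_order all_algebra finmap.
From mathcomp Require Export all_classical all_reals all_analysis.

Set Implicit Arguments.
Unset Strict Implicit.
Unset Printing Implicit Defensive.

Export Order.TTheory GRing.Theory Num.Theory.
Export numFieldNormedType.Exports.

Local Open Scope classical_set_scope.
Local Open Scope ring_scope.

Definition mutually_independent (R : realType) (d d' : measure_display)
    (T : measurableType d) (U : measurableType d') (P : probability T R)
    (X : nat -> {RV P >-> U}) : Prop :=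
  forall (J : {fset nat}) (B : nat -> set U), (forall j, measurable (B j)) ->
    P (\bigcap_(j in [set` J]) (X j @^-1` B j)) =
    (\prod_(j <- J) P (X j @^-1` B j))%E.

(* [true] stands for Heads; the [N]-th toss is [toss N.-1]. *)
Definition fair_coin_tosses (R : realType) (d : measure_display)
    (T : measurableType d) (P : probability T R)
    (toss : nat -> {RV P >-> bool}) : Prop :=
  mutually_independent toss /\
  forall (i : nat) (b : bool), P (toss i @^-1` [set b]) = (2^-1)%:E.

Definition heads (T : Type) (toss : nat -> T -> bool) (N : nat) (w : T) : nat :=
  (\sum_(i < N) toss i w)%N.

Definition tails (T : Type) (toss : nat -> T -> bool) (N : nat) (w : T) : nat :=
  (\sum_(i < N) ~~ toss i w)%N.

(* The minimum is given the arbitrary value 0 when no [N] satisfies [A]; for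
   the two stopping times below this only happens on a null set of outcomes. *)
Definition first_time (A : pred nat) : nat :=
  if pselect (exists N, A N) is left exA then ex_minn exA else 0%N.

Definition X1 (T : Type) (toss : nat -> T -> bool) (n : nat) (w : T) : nat :=
  first_time [pred N | (heads toss N w == n) || (tails toss N w == n)].

Definition X2 (T : Type) (toss : nat -> T -> bool) (n : nat) (w : T) : nat :=
  first_time [pred N | (n <= heads toss N w)%N && (n <= tails toss N w)%N].

Section convergence.
Context (R : realType) (d d' : measure_display).
Context (T : measurableType d) (T' : measurableType d').
Context (P : probability T R) (P' : probability T' R).
Context (Y : nat -> T -> R) (Y' : T' -> R).

Definition cvg_in_distribution : Prop :=
  forall f : R -> R, continuous f -> bounded_fun f ->
    'E_P[f \o Y n]%E @[n --> \oo] --> 'E_P'[f \o Y']%E.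

Definition cvg_ordinary_moments : Prop :=
  forall k : nat, (1 <= k)%N ->
    'E_P[fun w => (Y n w ^+ k)%R]%E @[n --> \oo] --> 'E_P'[fun w => (Y' w ^+ k)%R]%E.

Definition cvg_absolute_moments : Prop :=
  forall r : R, 0 < r ->
    'E_P[fun w => (`|Y n w| `^ r)%R]%E @[n --> \oo] -->
    'E_P'[fun w => (`|Y' w| `^ r)%R]%E.

Definition cvg_distribution_with_all_moments : Prop :=
  [/\ cvg_in_distribution, cvg_ordinary_moments & cvg_absolute_moments].

End convergence.

(* The library's expectation is extended-real valued. *)
Definition mean (R : realType) (d : measure_display) (T : measurableType d)
    (P : probability T R) (X : T -> R) : R := fine 'E_P[X]%E.

(* Main.v *)
Require Import Defs.
From mathcomp Require Import ring lra zify measurable_realfun.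

(** The waiting times X1(n) and X2(n) are the times V of the n-th Head and W of
the n-th Tail put in order, and P(V = N) = P(W = N) is a binomial coefficient
over a power of 2. Since V < 2n exactly when W >= 2n, on either side of 2n only
one of X1(n), X2(n) can occur, and both take the value N with the probability
'C(N - 1, n - 1) / 2^(N - 1) that toss N completes n Heads or n Tails
([prob_completes]). So the earliness E = 2n - 1 - X1(n) and the lateness
L = X2(n) - 2n are two natural-valued variables with explicit weights.

For both, p(m + 1) = p(m) (1 - a(m)) with a(m) close to m / (2n)
([earliness_pmfS], [lateness_pmfS]). Multiplying these ratios, p(m) / p(0) is
squeezed between two exponentials ([gaussian_decay_ge], [gaussian_decay_le]) and
tends to exp(- z^2 / 2) when m = floor(z sqrt(2n)) ([gaussian_decay_cvg]), while
it stays below exp(1/2 - m / (4 sqrt n)) for every m and n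
([gaussian_decay_dominated]).

The expectation of u(E) is a sum over m, that is, the integral over z >= 0 of a
step function which is constant on the cells of a grid of mesh 1 / sqrt(2n)
([integral_nat_valued_transfer]). Dominated convergence applies to all functions
u of growth at most exp(m / (8 sqrt n)) at once ([dominated_riemann_sum]). The
unknown factor p(0) sqrt(2n) is then determined by the total mass: with u = 1 the
expectation is 1 for every n, so the factor converges to the constant of the
half-normal density, and neither Stirling's nor Wallis's formula is called upon
([nat_valued_expectation_cvg]).

Bounded continuous functions, powers and absolute powers are all continuous and
of subexponential growth, so convergence in distribution and convergence of
moments are instances of a single statement ([shifted_expectation_cvg]). It
allows a convergent shift, because centering at the mean is a shift of the
variable by (mean - 2n) / sqrt n, and that quantity converges by the same
statement applied to the identity function ([mean_cvg]). *)

Set Implicit Arguments.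
Unset Strict Implicit.
Unset Printing Implicit Defensive.

Local Open Scope classical_set_scope.
Local Open Scope ring_scope.

(** * The waiting times along one sequence of tosses *)

Section paths.
Context (T : Type) (toss : nat -> T -> bool).
Implicit Types (n N : nat) (w : T).

Lemma headsS N w : heads toss N.+1 w = (heads toss N w + toss N w)%N.
Proof. by rewrite /heads big_ord_recr. Qed.

Lemma tailsS N w : tails toss N.+1 w = (tails toss N w + ~~ toss N w)%N.
Proof. by rewrite /tails big_ord_recr. Qed.

Lemma heads_tails N w : (heads toss N w + tails toss N w = N)%N.
Proof.
elim: N => [|N IH]; first by rewrite /heads /tails !big_ord0.
by rewrite headsS tailsS; case: (toss N w) => /=; lia.
Qed.

Lemma leq_heads N N' w : (N <= N')%N -> (heads toss N w <= heads toss N' w)%N.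
Proof.
move=> /subnKC <-; elim: (N' - N)%N => [|k IH]; first by rewrite addn0.
by rewrite addnS headsS; lia.
Qed.

Lemma leq_tails N N' w : (N <= N')%N -> (tails toss N w <= tails toss N' w)%N.
Proof.
move=> /subnKC <-; elim: (N' - N)%N => [|k IH]; first by rewrite addn0.
by rewrite addnS tailsS; lia.
Qed.

(** Tosses are numbered from 0: the one with index [N], the [N.+1]-st, brings one
face from [n] to [n.+1] occurrences. *)
Definition completes n N w : bool :=
  (heads toss N w == n) && toss N w || (tails toss N w == n) && ~~ toss N w.

Lemma first_time_eqS (A : pred nat) N : ~~ A 0%N ->
  first_time A = N.+1 <-> A N.+1 /\ forall M, (M <= N)%N -> ~~ A M.
Proof.
move=> A0; rewrite /first_time; case: pselect => [exA|nA]; last first.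
  by split=> // -[AN _]; exfalso; apply: nA; exists N.+1.
case: ex_minnP => m Am mmin; split => [mN|[AN AM]].
  rewrite mN in Am mmin; split => // M MN; apply/negP => /mmin; lia.
apply/eqP; rewrite eqn_leq mmin //= ltnNge; apply/negP => mN.
by move: (AM _ mN); rewrite Am.
Qed.

(** If toss [N.+1] is a Head that makes [n.+1] Heads and [N <= 2 n], then at most
[n] Tails have been seen, so neither face was complete earlier. *)
Lemma X1_eqS n N w : (N <= n.*2)%N -> X1 toss n.+1 w = N.+1 <-> completes n N w.
Proof.
move=> Nn; rewrite /X1 first_time_eqS /=; last by rewrite /heads /tails !big_ord0.
have := heads_tails N w; rewrite /completes; split.
  move=> [+ /(_ N (leqnn _))]; rewrite headsS tailsS.
  by case: (toss N w) => /=; lia.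
move=> cN; split; first by move: cN; rewrite headsS tailsS; case: (toss N w) => /=; lia.
move=> M MN; have := leq_heads w MN; have := leq_tails w MN.
by move: cN; case: (toss N w) => /=; lia.
Qed.

Lemma X1_bounds n w : (0 < X1 toss n.+1 w <= n.*2.+1)%N.
Proof.
rewrite /X1 /first_time; case: pselect => [exA|nA].
  case: ex_minnP => m Am mmin; apply/andP; split.
    by case: m Am {mmin} => //; rewrite /= /heads /tails !big_ord0.
  (* pigeonhole: some face shows at least n + 1 times in 2 n + 1 tosses *)
  rewrite leqNgt; apply/negP => nm.
  have lt_n M : (M < m)%N -> (heads toss M w <= n)%N /\ (tails toss M w <= n)%N.
    elim: M => [|M IH] Mm; first by rewrite /heads /tails !big_ord0.
    have := IH (ltnW Mm).
    have : ~~ [pred N | (heads toss N w == n.+1) || (tails toss N w == n.+1)] M.+1.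
      by apply/negP => /mmin; lia.
    rewrite /= headsS tailsS; case: (toss M w) => /=; lia.
  by have := lt_n _ nm; have := heads_tails n.*2.+1 w; lia.
exfalso; apply: nA.
suff [N]: exists N, (heads toss N w >= n.+1)%N || (tails toss N w >= n.+1)%N.
  elim: N => [|N IH]; first by rewrite /heads /tails !big_ord0.
  have [/IH //|nN] := boolP ((heads toss N w >= n.+1)%N || (tails toss N w >= n.+1)%N).
  move=> h; exists N.+1; move: h nN.
  by rewrite /= headsS tailsS; case: (toss N w) => /=; lia.
by exists n.*2.+1; have := heads_tails n.*2.+1 w; lia.
Qed.

(** If toss [N.+1] is a Head that makes [n.+1] Heads and [2 n < N], then there
are already at least [n.+1] Tails, so this toss completes the later face. *)
Lemma X2_eqS n N w : (n.*2 < N)%N -> X2 toss n.+1 w = N.+1 <-> completes n N w.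
Proof.
move=> Nn; rewrite /X2 first_time_eqS /=; last by rewrite /heads /tails !big_ord0.
have := heads_tails N w; rewrite /completes; split.
  move=> [+ /(_ N (leqnn _))]; rewrite headsS tailsS.
  by case: (toss N w) => /=; lia.
move=> cN; split; first by move: cN; rewrite headsS tailsS; case: (toss N w) => /=; lia.
move=> M MN; have := leq_heads w MN; have := leq_tails w MN.
by move: cN; case: (toss N w) => /=; lia.
Qed.

(** The value 0 stands for an infinite waiting time. *)
Lemma X2_ge n w : X2 toss n.+1 w != 0%N -> (n.*2.+2 <= X2 toss n.+1 w)%N.
Proof.
rewrite /X2 /first_time; case: pselect => // exA.
case: ex_minnP => m /= Am _ _; have := heads_tails m w; lia.
Qed.

Lemma X2_eq0 n N w : X2 toss n.+1 w = 0%N ->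
  (heads toss N w <= n)%N \/ (tails toss N w <= n)%N.
Proof.
move=> X0; apply/orP; apply: contrapT => /negP hN; move: X0.
rewrite /X2 /first_time; case: pselect => [exA|[]]; last first.
  by exists N => /=; move: hN; lia.
case: ex_minnP => m /= + _ m0; by rewrite m0 /heads /tails !big_ord0.
Qed.

End paths.

(** * The laws of the waiting times *)

Section fair_coin.
Context (R : realType) (d : measure_display) (T : measurableType d).
Context (P : probability T R) (toss : nat -> {RV P >-> bool}).
Hypothesis toss_fair : fair_coin_tosses toss.
Implicit Types (n N : nat) (w : T) (b : bool).

Definition heads_set N w : {set 'I_N} := [set i : 'I_N | toss i w].

Lemma card_heads_set N w : #|heads_set N w| = heads toss N w.
Proof.
rewrite /heads -sum1_card big_mkcond /=; apply: eq_bigr => i _.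
by rewrite inE; case: (toss i w).
Qed.

Lemma card_tails_set N w : #|~: heads_set N w| = tails toss N w.
Proof.
rewrite /tails -sum1_card big_mkcond /=; apply: eq_bigr => i _.
by rewrite !inE; case: (toss i w).
Qed.

Let outcome N (S : {set 'I_N}) b (j : nat) : set bool :=
  [set (if insub j is Some i then i \in S else b)].

Let times N : {fset nat} := seq_fset tt (iota 0 N.+1).

Let in_times N j : (j \in times N) = (j <= N)%N.
Proof. by rewrite seq_fsetE mem_iota add0n ltnS. Qed.

(** The outcome of the first [N.+1] tosses is prescribed by the set of the Heads
among the first [N] and by the last toss, kept apart because the event
[completes n N] asks for a count of the former together with a face of the
latter. *)
Lemma cylinderE N (S : {set 'I_N}) b :
  [set w | heads_set N w = S /\ toss N w = b] =
  \bigcap_(j in [set` times N]) (toss j @^-1` outcome S b j).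
Proof.
apply/seteqP; split => [w [<- <-] j jt|w cylw].
  have jN : (j <= N)%N by rewrite -in_times.
  rewrite /outcome /preimage /mkset; case: insubP => [i _ <-|]; first by rewrite inE.
  by rewrite -leqNgt => Nj; congr (toss _ w); lia.
have cyl j : (j <= N)%N -> toss j w = if insub j is Some i then i \in S else b.
  by move=> jN; apply: (cylw j); rewrite /mkset in_times.
split; last by rewrite cyl//; case: insubP => // i; rewrite ltnn.
apply/setP => i; rewrite inE cyl ?(ltnW (ltn_ord i))//.
by case: insubP => [j _ /val_inj -> //|]; rewrite ltn_ord.
Qed.

Lemma measurable_cylinder N (S : {set 'I_N}) b :
  measurable [set w | heads_set N w = S /\ toss N w = b].
Proof.
rewrite cylinderE; apply: fin_bigcap_measurable => // j _.
by rewrite -[X in measurable X]setTI; exact: measurable_funP.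
Qed.

Lemma prob_cylinder N (S : {set 'I_N}) b :
  P [set w | heads_set N w = S /\ toss N w = b] = ((2^-1) ^+ N.+1)%:E.
Proof.
have [indep fair] := toss_fair.
rewrite cylinderE indep; last by [].
rewrite (eq_bigr (fun=> (2^-1)%:E)); last by move=> j _; rewrite fair.
rewrite prodEFin; congr EFin.
rewrite big_const_seq count_predT size_seq_fset undup_id ?iota_uniq// size_iota.
by rewrite -Monoid.iteropE.
Qed.

Lemma event_bigcup N b (Q : pred {set 'I_N}) :
  [set w | Q (heads_set N w) && (toss N w == b)] =
  \bigcup_(S in [set` Q]) [set w | heads_set N w = S /\ toss N w = b].
Proof.
apply/seteqP; split => [w /= /andP[Qw /eqP tw]|w [S /= QS [-> ->]]].
  by exists (heads_set N w).
by rewrite eqxx andbT.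
Qed.

Lemma measurable_event N b (Q : pred {set 'I_N}) :
  measurable [set w | Q (heads_set N w) && (toss N w == b)].
Proof.
rewrite event_bigcup; apply: fin_bigcup_measurable => // S _.
exact: measurable_cylinder.
Qed.

Lemma prob_event N b (Q : pred {set 'I_N}) :
  P [set w | Q (heads_set N w) && (toss N w == b)] =
  (#|Q|%:R * (2^-1) ^+ N.+1)%:E.
Proof.
have -> : [set w | Q (heads_set N w) && (toss N w == b)] =
    \bigcup_(S in [set` enum Q]) [set w | heads_set N w = S /\ toss N w = b].
  by rewrite event_bigcup; congr bigcup; apply/seteqP; split=> S /=; rewrite mem_enum.
rewrite measure_fin_bigcup//; last 2 first.
- by move=> S S' _ _ [w [[<- _] [<- _]]].
- by move=> S _; exact: measurable_cylinder.
rewrite -fsbig_seq ?enum_uniq//=.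
under eq_bigr do rewrite prob_cylinder.
by rewrite sumEFin big_enum sumr_const mulr_natl.
Qed.

Lemma completes_event n N :
  [set w | completes toss n N w] =
  [set w | [pred S : {set 'I_N} | #|S| == n] (heads_set N w) && (toss N w == true)] `|`
  [set w | [pred S : {set 'I_N} | #|~: S| == n] (heads_set N w) && (toss N w == false)].
Proof.
apply/seteqP; split => w /=; rewrite card_heads_set card_tails_set eqb_id eqbF_neg.
  by move=> /orP.
by move=> ?; apply/orP.
Qed.

Lemma measurable_completes n N : measurable [set w | completes toss n N w].
Proof. by rewrite completes_event; apply: measurableU; exact: measurable_event. Qed.

Lemma card_sets_of_card n N : #|[pred S : {set 'I_N} | #|S| == n]| = 'C(N, n).
Proof.
rewrite -[in RHS](card_ord N) -card_draws.
by apply: eq_card => S; rewrite !inE.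
Qed.

Lemma prob_completes n N :
  P [set w | completes toss n N w] = ('C(N, n)%:R * (2^-1) ^+ N)%:E.
Proof.
rewrite completes_event measureU;
  [|exact: measurable_event|exact: measurable_event|]; last first.
  by apply/seteqP; split => // w /= [/andP[_ /eqP ->]] /andP[].
have cardC : #|[pred S : {set 'I_N} | #|~: S| == n]| = 'C(N, n).
  rewrite -card_sets_of_card -(card_imset _ (inv_inj (@finset.setCK _))).
  apply: eq_card => S; apply/imsetP/idP => [[S' + ->]|]; rewrite !inE => SN //.
  by exists (~: S)%SET; rewrite ?inE finset.setCK.
rewrite [X in (X + _)%E]prob_event [X in (_ + X)%E]prob_event cardC card_sets_of_card.
by rewrite -EFinD exprS; congr EFin; field.
Qed.

(** Exponential Markov inequality: the indicator of [#|S| <= n] is at most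
[2 ^ (n - #|S|)], and summing [2 ^ - #|S|] over all sets gives [(3 / 2) ^ N]. The
involution [f] is the identity for Heads and the complement for Tails. *)
Lemma card_few_heads n N (f : {set 'I_N} -> {set 'I_N}) : involutive f ->
  (#|[pred S : {set 'I_N} | (#|f S| <= n)%N]|%:R : R) <= 2 ^+ n * (3 / 2) ^+ N.
Proof.
move=> fK; rewrite -sum1_card natr_sum.
have -> : (3 / 2) ^+ N = \sum_(S : {set 'I_N}) 2^-1 ^+ #|S| :> R.
  transitivity (\prod_(i < N) (2^-1 + 1) : R).
    by rewrite prodr_const card_ord; congr (_ ^+ N); field.
  rewrite bigA_distr; apply: eq_bigr => S _.
  by rewrite -big_mkcond prodr_const.
rewrite [X in _ * X](reindex f) /=; last by exists f => S _; exact: fK.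
rewrite mulr_sumr big_mkcond /=; apply: ler_sum => S _.
rewrite inE; case: ifPn => fS; last by rewrite mulr_ge0// exprn_ge0.
rewrite -(subnK fS) exprD -mulrA -exprMn divff ?expr1n ?mulr1 ?pnatr_eq0//.
by rewrite exprn_ege1// ler1n.
Qed.

Lemma X2_preimage0 n : [set w | X2 toss n.+1 w = 0%N] =
  ~` \bigcup_(N in [set N | (n.*2 < N)%N]) [set w | completes toss n N w].
Proof.
apply/seteqP; split => w /=.
  by move=> X0 [N /= nN /(X2_eqS toss w nN)]; rewrite X0.
apply: contra_notP => /eqP X0; have := X2_ge X0.
case E : X2 => [//|N] nN; exists N => /=; first by lia.
by apply/X2_eqS => //; lia.
Qed.

Lemma measurable_X2_preimage0 n : measurable [set w | X2 toss n.+1 w = 0%N].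
Proof.
rewrite X2_preimage0; apply: measurableC; apply: bigcup_measurable => N _.
exact: measurable_completes.
Qed.

(** Almost surely both faces show more than [n] times: the probability that one
of them shows at most [n] times in [N] tosses is at most [2 ^ (n + 1)] times
[(3 / 4) ^ N]. *)
Lemma prob_X2_preimage0 n : P [set w | X2 toss n.+1 w = 0%N] = 0%E.
Proof.
have bound N : (P [set w | X2 toss n.+1 w = 0%N] <=
    (2 * 2 ^+ n * (3 / 4) ^+ N)%:E)%E.
  pose Q := [pred S : {set 'I_N} | (#|S| <= n)%N || (#|~: S| <= n)%N].
  apply: (@le_trans _ _ (P (
     [set w | Q (heads_set N w) && (toss N w == true)] `|`
     [set w | Q (heads_set N w) && (toss N w == false)]))).
    apply: le_measure; rewrite ?inE.
    - exact: measurable_X2_preimage0.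
    - by apply: measurableU; exact: measurable_event.
    - move=> w X0; have /orP := X2_eq0 N X0.
      rewrite -card_heads_set -card_tails_set => Qw.
      by case tw : (toss N w); [left|right]; rewrite /= tw eqxx Qw.
  rewrite measureU; [|exact: measurable_event|exact: measurable_event|]; last first.
    by apply/seteqP; split => // w /= [/andP[_ /eqP ->]] /andP[].
  rewrite [X in (X + _)%E]prob_event [X in (_ + X)%E]prob_event -EFinD lee_fin.
  have QS : #|Q|%:R <= 2 * (2 ^+ n * (3 / 2) ^+ N) :> R.
    rewrite mulrDl mul1r.
    apply: le_trans (lerD (@card_few_heads n N id _)
      (card_few_heads n (@finset.setCK _))) => //.
    rewrite -natrD ler_nat -cardUI; apply: leq_trans (leq_addr _ _).
    by apply: subset_leq_card; apply/fintype.subsetP => S; rewrite !inE.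
  rewrite exprS (_ : 3 / 4 = 3 / 2 * 2^-1); last by field.
  rewrite exprMn; have := ler_wpM2r (exprn_ge0 N (_ : 0 <= 2^-1 :> R)) QS.
  by rewrite invr_ge0 ler0n => /(_ isT); lra.
apply/eqP; rewrite eq_le measure_ge0 andbT.
have : (2 * 2 ^+ n * (3 / 4) ^+ N)%:E @[N --> \oo] --> (0 : \bar R)%E.
  apply: cvg_EFin; first exact: nearW.
  rewrite -(mulr0 (2 * 2 ^+ n)); apply: cvgMr; apply: cvg_expr.
  by rewrite ger0_norm; lra.
by apply: cvge_ge; exact: nearW.
Qed.

(** How long before toss [2 n + 1], the last possible moment, the first face
reaches [n.+1], and how long after toss [2 n + 2], the first possible moment, the
second one does. *)
Definition earliness n w : nat := (n.*2.+1 - X1 toss n.+1 w)%N.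
Definition lateness n w : nat := (X2 toss n.+1 w - n.*2.+2)%N.

Definition earliness_pmf n m : R :=
  if (m <= n)%N then 'C(n.*2 - m, n)%:R * (2^-1) ^+ (n.*2 - m) else 0.
Definition lateness_pmf n m : R := 'C(n.*2.+1 + m, n)%:R * (2^-1) ^+ (n.*2.+1 + m).

Lemma earliness_preimage n m :
  earliness n @^-1` [set m] =
  if (m <= n.*2)%N then [set w | completes toss n (n.*2 - m) w] else set0.
Proof.
apply/seteqP; split => w; rewrite /earliness /=; have := X1_bounds toss n w.
  case: ifPn => [mn X1n <-|]; last first.
    by move=> mn; move: (X1 _ _ _) => x X1n Xm; exfalso; move: mn X1n Xm; lia.
  by apply/X1_eqS; move: mn X1n; move: (X1 _ _ _) => x; lia.
case: ifPn => // mn X1n /X1_eqS -> ; lia.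
Qed.

Lemma measurable_earliness n m : measurable (earliness n @^-1` [set m]).
Proof.
by rewrite earliness_preimage; case: ifP => // _; exact: measurable_completes.
Qed.

Lemma prob_earliness n m : P (earliness n @^-1` [set m]) = (earliness_pmf n m)%:E.
Proof.
rewrite earliness_preimage /earliness_pmf; case: (leqP m n) => mn.
  by rewrite ifT; [rewrite prob_completes|lia].
case: ifP => m2n; last by rewrite measure0.
by rewrite prob_completes bin_small ?mul0r//; lia.
Qed.

Lemma lateness_preimage n m :
  lateness n @^-1` [set m] = [set w | completes toss n (n.*2.+1 + m) w] `|`
    (if m == 0%N then [set w | X2 toss n.+1 w = 0%N] else set0).
Proof.
have nm : (n.*2 < n.*2.+1 + m)%N by lia.
apply/seteqP; split => w; rewrite /lateness /=.
  have [X0|X0] := eqVneq (X2 toss n.+1 w) 0%N.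
    by rewrite X0 => <-; right; rewrite sub0n eqxx.
  have X2n := X2_ge X0; move=> Xm; left; apply/(X2_eqS toss w nm).
  by move: X2n Xm; move: (X2 _ _ _) => x; lia.
move=> [/(X2_eqS toss w nm) -> | ]; first by lia.
by case: eqVneq => //= -> X0; rewrite -[X2 _ _ _]/(X2 toss n.+1 w) X0.
Qed.

Lemma measurable_lateness n m : measurable (lateness n @^-1` [set m]).
Proof.
rewrite lateness_preimage; apply: measurableU; first exact: measurable_completes.
by case: ifP => // _; exact: measurable_X2_preimage0.
Qed.

(** When the second face is never completed the truncated subtraction gives
lateness 0, which changes [P (lateness n @^-1` [set 0])] by a null set only. *)
Lemma prob_lateness n m : P (lateness n @^-1` [set m]) = (lateness_pmf n m)%:E.
Proof.
rewrite lateness_preimage -[RHS]prob_completes measureU0//.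
- exact: measurable_completes.
- by case: ifP => // _; exact: measurable_X2_preimage0.
- by case: ifP => // _; rewrite ?measure0//; exact: prob_X2_preimage0.
Qed.

Lemma X1_earliness n w : X1 toss n.+1 w = (n.*2.+1 - earliness n w)%N.
Proof. by rewrite /earliness subKn//; have /andP[] := X1_bounds toss n w. Qed.

Lemma X2_lateness n w : X2 toss n.+1 w <> 0%N ->
  X2 toss n.+1 w = (n.*2.+2 + lateness n w)%N.
Proof. by move=> /eqP X0; rewrite /lateness subnKC//; exact: X2_ge. Qed.

Lemma measurable_X2_preimage n k : measurable [set w | X2 toss n.+1 w = k].
Proof.
case: k => [|k]; first exact: measurable_X2_preimage0.
have [nk|kn] := leqP n.*2.+1 k; last first.
  rewrite (_ : mkset _ = set0)//; apply/seteqP; split => // w /= Xk.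
  have : (n.*2.+2 <= X2 toss n.+1 w)%N by apply: X2_ge; rewrite Xk.
  by rewrite Xk; lia.
rewrite (_ : mkset _ = [set w | completes toss n k w]); first exact: measurable_completes.
by apply/seteqP; split => w /= /(X2_eqS toss w nk).
Qed.

Lemma earliness_pmfS n m : earliness_pmf n m.+1 =
  earliness_pmf n m * (1 - (if (m < n)%N then m%:R / (n.*2 - m)%:R else 1)).
Proof.
rewrite /earliness_pmf; case: (ltnP m n) => mn; last by rewrite subrr mulr0.
rewrite (ltnW mn) (_ : n.*2 - m = (n.*2 - m.+1).+1)%N; last by lia.
set N := (n.*2 - m.+1)%N.
have := mul_bin_down N.+1 n; rewrite /= => /(congr1 (fun k => k%:R : R)).
have -> : (N.+1 - n = n - m)%N by rewrite /N; lia.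
rewrite !natrM natrB ?(ltnW mn)// => binE.
have -> : m%:R = n%:R *+ 2 - N.+1%:R :> R.
  have : (m + N.+1)%:R = n.*2%:R :> R by congr _%:R; rewrite /N; lia.
  rewrite natrD -mul2n natrM; lra.
have N0 : N.+1%:R != 0 :> R by rewrite pnatr_eq0.
apply: (mulfI N0).
rewrite mulrA binE exprS.
have -> : m%:R = n%:R *+ 2 - N.+1%:R :> R.
  have : (m + N.+1)%:R = n.*2%:R :> R by congr _%:R; rewrite /N; lia.
  rewrite natrD -mul2n natrM; lra.
by field.
Qed.

Lemma lateness_pmfS n m : lateness_pmf n m.+1 =
  lateness_pmf n m * (1 - m.+2%:R / (2 * (n + m.+2)%:R)).
Proof.
rewrite /lateness_pmf addnS; set N := (n.*2.+1 + m)%N.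
have := mul_bin_down N.+1 n; rewrite /= => /(congr1 (fun k => k%:R : R)).
have -> : (N.+1 - n = n + m.+2)%N by rewrite /N; lia.
rewrite !natrM => binE.
have k0 : (n + m.+2)%:R != 0 :> R by rewrite pnatr_eq0 addnS.
apply: (mulfI k0).
rewrite mulrA -binE exprS.
have -> : m.+2%:R = (n + m.+2)%:R *+ 2 - N.+1%:R :> R.
  have : (m.+2 + N.+1)%:R = (n + m.+2).*2%:R :> R by congr _%:R; rewrite /N; lia.
  rewrite natrD -[in X in _ = X]mul2n natrM; lra.
by field.
Qed.

End fair_coin.

(** * Expectations of natural-valued variables as Lebesgue integrals *)

Section nat_valued.
Context (R : realType) (d : measure_display) (T : measurableType d).
Variables (mu : {measure set T -> \bar R}) (D : set T) (X : T -> nat).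
Hypothesis mX : forall k, measurable (D `&` X @^-1` [set k]).

Lemma measurable_fun_nat_valued d' (U : measurableType d') (F : nat -> U) :
  measurable_fun D (F \o X).
Proof.
move=> _ Y mY.
have -> : D `&` (F \o X) @^-1` Y =
    \bigcup_(k in [set k | Y (F k)]) (D `&` X @^-1` [set k]).
  apply/seteqP; split => [x [Dx /= YFX]|x [k /= YFk [Dx Xk]]].
    by exists (X x).
  by split => //=; rewrite Xk.
exact: bigcup_measurable.
Qed.

Lemma ge0_integral_nat_valued (F : nat -> \bar R) : (forall k, 0 <= F k)%E ->
  (\int[mu]_(x in D) F (X x) =
   \sum_(0 <= k <oo) F k * mu (D `&` X @^-1` [set k]))%E.
Proof.
move=> F0.
have DE : D = \bigcup_k (D `&` X @^-1` [set k]).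
  by apply/seteqP; split => [x Dx|x [k _ []]//]; exists (X x).
rewrite [X in integral _ X _]DE ge0_integral_bigcup//.
- apply: eq_eseriesr => k _; rewrite -integral_cst//; apply: eq_integral => x.
  by rewrite inE /= => -[_ ->].
- by rewrite -DE; exact: (measurable_fun_nat_valued F).
- by move=> i j _ _ [x [[_ <-] [_ <-]]].
Qed.

End nat_valued.

(** Reduces identities between integrals to nonnegative integrands, whether or
not the integrand is integrable. *)
Lemma integral_funr_posneg (R : realType) (d : measure_display)
    (T : measurableType d) (mu : {measure set T -> \bar R}) (D : set T) (f : T -> R) :
  (\int[mu]_(x in D) (f x)%:E =
   \int[mu]_(x in D) (Num.max (f x) 0)%:E - \int[mu]_(x in D) (Num.max (- f x) 0)%:E)%E.
Proof.
rewrite integralE; congr (_ - _)%E; apply: eq_integral => x _;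
  by rewrite ?funeposE ?funenegE -?EFinN EFin_max.
Qed.

(** Both integrals are the sum of the [f k] against the common weights
[mu (X = k) = p k * nu (Y = k)]. It is applied with [nu] the Lebesgue measure and
[Y] the number of a grid cell, to turn an expectation into the integral of a step
function. *)
Lemma integral_nat_valued_transfer (R : realType) (d d' : measure_display)
    (T : measurableType d) (U : measurableType d')
    (mu : {measure set T -> \bar R}) (nu : {measure set U -> \bar R})
    (D : set T) (E : set U) (X : T -> nat) (Y : U -> nat) (p f : nat -> R) :
  (forall k, measurable (D `&` X @^-1` [set k])) ->
  (forall k, measurable (E `&` Y @^-1` [set k])) ->
  (forall k, 0 <= p k) ->
  (forall k, mu (D `&` X @^-1` [set k]) = (p k)%:E * nu (E `&` Y @^-1` [set k]))%E ->
  (\int[mu]_(x in D) (f (X x))%:E = \int[nu]_(y in E) (f (Y y) * p (Y y))%:E)%E.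
Proof.
move=> mX mY p0 muE.
have ge0_case (g : nat -> R) : (forall k, 0 <= g k) ->
    (\int[mu]_(x in D) (g (X x))%:E = \int[nu]_(y in E) (g (Y y) * p (Y y))%:E)%E.
  move=> g0; rewrite (@ge0_integral_nat_valued _ _ _ mu D X mX (EFin \o g))//=.
  rewrite (@ge0_integral_nat_valued _ _ _ nu E Y mY (fun k => (g k * p k)%:E))//=.
    by apply: eq_eseriesr => k _; rewrite muE EFinM muleA.
  by move=> k; rewrite lee_fin mulr_ge0.
rewrite [LHS]integral_funr_posneg [RHS]integral_funr_posneg.
rewrite (ge0_case (fun k => Num.max (f k) 0)); last by move=> k; rewrite le_max lexx orbT.
rewrite (ge0_case (fun k => Num.max (- f k) 0)); last by move=> k; rewrite le_max lexx orbT.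
by congr (_ - _)%E; apply: eq_integral => y _; rewrite maxr_pMl// ?mul0r ?mulNr.
Qed.

Section truncation.
Context (R : realType).

Definition halfline : set R := `[0, +oo[%classic.

Lemma truncn_preimage (s : R) k : 0 < s ->
  halfline `&` (fun z => Num.truncn (z * s)) @^-1` [set k] =
  `[k%:R / s, k.+1%:R / s[%classic.
Proof.
move=> s0; apply/seteqP; split => z; rewrite /halfline /= !in_itv /= ?andbT.
  by move=> [z0 <-]; rewrite ler_pdivrMr// ltr_pdivlMr// truncn_itv// mulr_ge0// ltW.
rewrite ler_pdivrMr// ltr_pdivlMr// => kz; split; last exact: truncn_def.
by rewrite -(pmulr_lge0 _ s0); case/andP: kz => + _; apply: le_trans.
Qed.

Lemma measurable_truncn_preimage (s : R) k : 0 < s ->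
  measurable (halfline `&` (fun z => Num.truncn (z * s)) @^-1` [set k]).
Proof. by move=> s0; rewrite truncn_preimage//; exact: measurable_itv. Qed.

Lemma lebesgue_truncn_preimage (s : R) k : 0 < s ->
  lebesgue_measure (halfline `&` (fun z => Num.truncn (z * s)) @^-1` [set k]) = (s^-1)%:E.
Proof.
move=> s0; rewrite truncn_preimage// lebesgue_measure_itv/= lte_fin.
rewrite ltr_pM2r ?invr_gt0// ltr_nat ltnSn -EFinD; congr EFin.
by rewrite -mulrBl -natrB// subSnn mul1r.
Qed.
End truncation.

(** * Products with Gaussian decay *)

Section decay.
Context (R : realType).
Implicit Types (a : nat -> R) (m N : nat).

Lemma prod_1B_le_expR a m : (forall i, (i < m)%N -> a i <= 1) ->
  \prod_(i < m) (1 - a i) <= expR (- \sum_(i < m) a i).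
Proof.
move=> a1; rewrite -sumrN expR_sum; apply: ler_prod => i _.
by rewrite subr_ge0 a1//= expR_ge1Dx.
Qed.

(** [1 - x >= exp (- x / (1 - x))] is [1 + y <= exp y] at [y = x / (1 - x)]. *)
Lemma prod_1B_ge_expR a m : (forall i, (i < m)%N -> a i < 1) ->
  expR (- \sum_(i < m) a i / (1 - a i)) <= \prod_(i < m) (1 - a i).
Proof.
move=> a1; rewrite -sumrN expR_sum; apply: ler_prod => i _.
have ai : 0 < 1 - a i by rewrite subr_gt0 a1.
rewrite expR_ge0 expRN invf_ple ?posrE ?expR_gt0//.
apply: le_trans (expR_ge1Dx _); rewrite le_eqVlt; apply/orP; left; apply/eqP.
by field; rewrite lt0r_neq0.
Qed.

(** Bounds on the relative decrease [a i] from one weight to the next, with main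
term [i / (2 N)], which makes the product of the [1 - a i] behave like
[exp (- m ^ 2 / (4 N))]. They are loose enough to hold both for the earliness and
for the lateness. *)
Definition gaussian_decay N a := forall i : nat,
  [/\ i%:R / (2 * (N + i.+1)%:R) <= a i, a i <= 1 &
      (i.+2 < N.*2)%N -> a i <= i.+2%:R / (N.*2 - i.+2)%:R].

Lemma sum_natr m : \sum_(i < m) i%:R = m%:R * (m%:R - 1) / 2 :> R.
Proof.
elim: m => [|m IH]; first by rewrite big_ord0 !mul0r.
by rewrite big_ord_recr /= IH -natr1; field.
Qed.

(** Bounding each denominator [N + i + 1] by [N + m] leaves an arithmetic sum. *)
Lemma gaussian_decay_le N a m : (0 < N)%N -> gaussian_decay N a ->
  \prod_(i < m) (1 - a i) <= expR (- (m%:R * (m%:R - 1) / (4 * (N%:R + m%:R)))).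
Proof.
move=> N0 dec; have Nm : 0 < (N%:R + m%:R : R) by rewrite -natrD ltr0n addn_gt0 N0.
apply: le_trans (prod_1B_le_expR _) _; first by move=> i _; have [] := dec i.
rewrite ler_expR lerN2.
have -> : m%:R * (m%:R - 1) / (4 * (N%:R + m%:R)) =
    \sum_(i < m) i%:R / (2 * (N%:R + m%:R)) :> R.
  by rewrite -mulr_suml sum_natr; field; rewrite lt0r_neq0.
apply: ler_sum => i _; have [+ _ _] := dec i; apply: le_trans.
rewrite ler_wpM2l// lef_pV2 ?posrE ?mulr_gt0 ?ltr0n ?addnS//.
by rewrite ler_pM2l// -natrD ler_nat -addnS leq_add2l.
Qed.

(** The upper bound on [a i] gives [a i / (1 - a i) <= (i + 2) / (2 (N - 1 - m))]
for [i < m], which leaves an arithmetic sum again. *)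
Lemma gaussian_decay_ge N a m : (m.+1 < N)%N -> gaussian_decay N a ->
  expR (- (m%:R * (m%:R + 3) / (4 * (N%:R - 1 - m%:R)))) <= \prod_(i < m) (1 - a i).
Proof.
move=> mN dec; have Nm : 0 < (N%:R - 1 - m%:R : R).
  by rewrite subr_gt0 ltrBrDr natr1 ltr_nat.
have small i : (i < m)%N -> a i <= i.+2%:R / (N.*2 - i.+2)%:R.
  by move=> im; have [_ _] := dec i; apply; lia.
have below i : (i < m)%N -> 0 < ((N.*2 - i.+2)%:R - i.+2%:R : R).
  by move=> im; rewrite -natrB ?ltr0n; lia.
have a_lt1 i : (i < m)%N -> a i < 1.
  move=> im; apply: le_lt_trans (small _ im) _.
  rewrite ltr_pdivrMr ?ltr0n ?mul1r; last by lia.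
  by rewrite -subr_gt0 below.
apply: le_trans (prod_1B_ge_expR a_lt1).
rewrite ler_expR lerN2.
have -> : m%:R * (m%:R + 3) / (4 * (N%:R - 1 - m%:R)) =
    \sum_(i < m) (i%:R + 2) / (2 * (N%:R - 1 - m%:R)) :> R.
  rewrite -mulr_suml big_split /= sum_natr sumr_const card_ord -mulr_natl.
  by field; rewrite lt0r_neq0.
apply: ler_sum => i _.
have v0 : 0 < (N.*2 - i.+2)%:R :> R by rewrite ltr0n; have := ltn_ord i; lia.
apply: (@le_trans _ _ (i.+2%:R / ((N.*2 - i.+2)%:R - i.+2%:R))).
  rewrite ler_pdivrMr ?subr_gt0 ?a_lt1// mulrAC ler_pdivlMr ?below//.
  have := small _ (ltn_ord i); rewrite ler_pdivlMr//.
  by rewrite !mulrBr mulr1 (mulrC _ (a i)) lerD2r.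
have -> : i%:R + 2 = i.+2%:R :> R by rewrite -(addn2 i) natrD.
rewrite ler_wpM2l// lef_pV2 ?posrE ?mulr_gt0 ?below//.
rewrite natrB; last by have := ltn_ord i; lia.
rewrite -mul2n natrM -(addn2 i) natrD.
have : (i%:R + 1 <= m%:R :> R) by rewrite natr1 ler_nat.
by lra.
Qed.

(** The Gaussian bound degenerates for [m] much larger than [N], where the
exponent only grows linearly in [m]. With [t = sqrt N] and [q = m / t] the
exponent of [gaussian_decay_le] is [q (q t - 1) / (4 (t + q))], which is at least
[(q - 2) / 4] as soon as [1 <= t]; a linear bound in [q] is all that is needed to
integrate subexponential functions. *)
Lemma gaussian_decay_dominated N a m : (0 < N)%N -> gaussian_decay N a ->
  \prod_(i < m) (1 - a i) <= expR (2^-1 - m%:R / Num.sqrt N%:R / 4).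
Proof.
move=> N0 dec; apply: le_trans (gaussian_decay_le m N0 dec) _.
rewrite ler_expR; set t := Num.sqrt N%:R; set x : R := m%:R.
have t1 : 1 <= t by rewrite -sqrtr1 ler_sqrt// ler1n.
have tN : N%:R = t ^+ 2 by rewrite sqr_sqrtr.
have x0 : 0 <= x by [].
have t0 : 0 < t by lra.
have D0 : 0 < 4 * (N%:R + x) by rewrite tN; nra.
rewrite lerNl ler_pdivlMr// tN.
set q := x / t; have xq : x = q * t by rewrite /q divfK// gt_eqF.
have q0 : 0 <= q by rewrite /q divr_ge0// ltW.
rewrite xq.
have -> : - (2^-1 - q / 4) * (4 * (t ^+ 2 + q * t)) =
    (q - 2) * (t ^+ 2 + q * t) by field.
suff : 0 <= t * (q * (q - 1) * (t - 1) + 2 * t) by nra.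
apply: mulr_ge0; first exact: ltW.
have := mulr_ge0 (_ : 0 <= t - 1) (sqr_ge0 (q - 2^-1)).
by rewrite subr_ge0 => /(_ t1); nra.
Qed.

End decay.

Section rescaled_limit.
Context (R : realType).

Definition rootn (n : nat) : R := Num.sqrt n.+1%:R.

Lemma rootn_gt0 n : 0 < rootn n. Proof. by rewrite sqrtr_gt0 ltr0n. Qed.

Lemma cvg_rootnV : (rootn n)^-1 @[n --> \oo] --> (0 : R).
Proof.
rewrite (_ : (fun n => (rootn n)^-1) = Num.sqrt \o harmonic); last first.
  by apply/funext => n; rewrite /= /harmonic /= /rootn sqrtrV.
rewrite -[X in _ --> X](@sqrtr0 R).
apply: continuous_cvg; [exact: sqrt_continuous|exact: cvg_harmonic].
Qed.

(** With [r = m / sqrt N] and [e = 1 / sqrt N] both bounds on the product are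
continuous functions of [r] and [e], with the same value at [e = 0]. *)
Lemma gaussian_decay_cvg (a : nat -> nat -> R) (m : nat -> nat) (q : R) :
  (forall n, gaussian_decay n.+1 (a n)) ->
  (m n)%:R / rootn n @[n --> \oo] --> q ->
  \prod_(i < m n) (1 - a n i) @[n --> \oo] --> expR (- (q ^+ 2 / 4)).
Proof.
move=> dec mq; have e0 := cvg_rootnV.
pose e n : R := (rootn n)^-1; pose r n : R := (m n)%:R / rootn n.
have mE n : (m n)%:R = r n * rootn n :> R by rewrite divfK// gt_eqF// rootn_gt0.
have nE n : n.+1%:R = rootn n ^+ 2 :> R by rewrite sqr_sqrtr.
have qe : 1 - e n ^+ 2 - r n * e n @[n --> \oo] --> (1 : R).
  rewrite -[X in _ --> X](_ : 1 - 0 ^+ 2 - q * 0 = 1); last by ring.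
  apply: cvgB; last exact: cvgM.
  apply: cvgB; first exact: cvg_cst.
  by rewrite expr2; under eq_fun do rewrite expr2; exact: cvgM.
apply: (@squeeze_cvgr _ _ _ _
  (fun n => expR (- (r n * (r n + 3 * e n) / (4 * (1 - e n ^+ 2 - r n * e n)))))
  (fun n => expR (- (r n * (r n - e n) / (4 * (1 + r n * e n)))))).
- have : \forall n \near \oo, 0 < 1 - e n ^+ 2 - r n * e n.
    by apply: (cvgr_gt 1).
  apply: filterS => n pos; have s0 := rootn_gt0 n.
  have sN0 : rootn n != 0 by rewrite gt_eqF.
  have r0 : 0 <= r n by rewrite divr_ge0// ltW.
  have pos' : 0 < rootn n ^+ 2 - 1 - r n * rootn n.
    have -> : rootn n ^+ 2 - 1 - r n * rootn n =
        rootn n ^+ 2 * (1 - e n ^+ 2 - r n * e n).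
      by rewrite /e; move: (r n) => x; field.
    by rewrite mulr_gt0// exprn_gt0.
  apply/andP; split.
    have -> : r n * (r n + 3 * e n) / (4 * (1 - e n ^+ 2 - r n * e n)) =
       (m n)%:R * ((m n)%:R + 3) / (4 * (n.+1%:R - 1 - (m n)%:R)).
      rewrite mE (nE n) /e; move: (r n) (rootn n) sN0 pos' => x s sN0 pos'.
      by field; rewrite sN0 /= gt_eqF.
    apply: gaussian_decay_ge => //.
    by rewrite -(ltr_nat R) -natr1 mE (nE n); lra.
  have -> : r n * (r n - e n) / (4 * (1 + r n * e n)) =
     (m n)%:R * ((m n)%:R - 1) / (4 * (n.+1%:R + (m n)%:R)).
    rewrite mE (nE n) /e; move: (r n) (rootn n) r0 s0 sN0 => x s r0 s0 sN0.
    have D1 : s ^+ 2 + x * s != 0 by rewrite gt_eqF//; nra.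
    have D2 : s + x != 0 by rewrite gt_eqF//; lra.
    by field; rewrite sN0 D1.
  exact: (gaussian_decay_le (m n) (ltn0Sn n) (dec n)).
- apply: continuous_cvg; first exact: continuous_expR.
  apply: cvgN.
  rewrite (_ : q ^+ 2 / 4 = q * (q + 3 * 0) / (4 * 1)); last by field.
  apply: cvgM.
    by apply: cvgM => //; apply: cvgD => //; apply: cvgM => //; exact: cvg_cst.
  by apply: cvgV; [by rewrite mulr1 pnatr_eq0|apply: cvgM => //; exact: cvg_cst].
- apply: continuous_cvg; first exact: continuous_expR.
  apply: cvgN.
  rewrite (_ : q ^+ 2 / 4 = q * (q - 0) / (4 * (1 + q * 0))); last by field.
  apply: cvgM; first by apply: cvgM => //; apply: cvgB.
  apply: cvgV; first by rewrite mulr0 addr0 mulr1 pnatr_eq0.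
  by apply: cvgM; [exact: cvg_cst|apply: cvgD; [exact: cvg_cst|exact: cvgM]].
Qed.

Lemma truncn_scaled_cvg (z : R) : 0 <= z ->
  (Num.truncn (z * Num.sqrt (2 * n.+1%:R)))%:R / rootn n @[n --> \oo] --> Num.sqrt 2 * z.
Proof.
move=> z0.
apply: (@squeeze_cvgr _ _ _ _
  (fun n => Num.sqrt 2 * z - (rootn n)^-1) (cst (Num.sqrt 2 * z))).
- apply: nearW => n; have s0 := rootn_gt0 n.
  rewrite sqrtrM// -/(rootn n).
  set x := z * _; have x0 : 0 <= x by rewrite !mulr_ge0// ltW.
  have /andP[lo hi] := truncn_itv x0.
  rewrite /cst ler_pdivlMr// ler_pdivrMr// mulrBl mulVf ?gt_eqF//.
  have -> : Num.sqrt 2 * z * rootn n = x by rewrite /x; ring.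
  by rewrite lo andbT lerBlDr natr1 ltW.
- rewrite -[X in _ --> X]subr0; apply: cvgB; [exact: cvg_cst|exact: cvg_rootnV].
- exact: cvg_cst.
Qed.
End rescaled_limit.

(** * Expectations of functions of the modulus of a normal variable *)

Section normal.
Context (R : realType).
Local Notation mu := (@lebesgue_measure R).
Local Notation phi := (@normal_pdf R 0 1).

(** The Radon-Nikodym derivative of the normal distribution is almost everywhere
its density. *)
Lemma ge0_integral_normal_prob (m s : R) (f : R -> \bar R) :
  measurable_fun [set: R] f -> (forall x, 0 <= f x)%E ->
  (\int[normal_prob m s]_x f x = \int[mu]_x (f x * (normal_pdf m s x)%:E))%E.
Proof.
move=> mf f0; have dom := normal_prob_dominates m s.
rewrite -(Radon_Nikodym_SigmaFinite.change_of_variables dom)//.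
apply: ae_eq_integral => //.
- apply: emeasurable_funM => //; apply: measurable_int.
  exact: Radon_Nikodym_SigmaFinite.f_integrable.
- apply: emeasurable_funM => //; apply/measurable_EFinP.
  exact: measurable_normal_pdf.
- apply: ae_eqe_mul2l; apply: integral_ae_eq => //.
  + exact: Radon_Nikodym_SigmaFinite.f_integrable.
  + by apply/measurable_EFinP; exact: measurable_normal_pdf.
  + by move=> A _ mA; rewrite -Radon_Nikodym_SigmaFinite.f_integral.
Qed.

Lemma normal_pdf01E x : phi x = normal_peak 1 * expR (- (x ^+ 2 / 2)).
Proof.
by rewrite normal_pdfE ?oner_neq0// /normal_fun subr0 expr1n mulNr.
Qed.

Lemma ge0_integral_normal_pdf_even (h : R -> R) :
  continuous h -> (forall x, 0 <= h x) ->
  (\int[mu]_x (h `|x| * phi x)%:E =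
   \int[mu]_(z in @halfline R) (h z * (2 * phi z))%:E)%E.
Proof.
move=> ch h0; have cabs : continuous (fun x : R => h `|x|).
  by move=> x; apply: (@continuous_comp _ _ _ _ h); [exact: norm_continuous|exact: ch].
rewrite (@ge0_symfun_integralT _ (fun x => h `|x| * phi x)); last 3 first.
- by move=> x; rewrite mulr_ge0// normal_pdf_ge0.
- move=> x; apply: continuousM; first exact: cabs.
  by apply: continuous_normal_pdf; rewrite oner_neq0.
- by move=> x /=; rewrite normrN !normal_pdf01E sqrrN.
rewrite -set_itvcy -ge0_integralZl//; last 2 first.
- apply: measurable_funTS; apply/measurable_EFinP.
  apply: measurable_funM; last exact: measurable_normal_pdf.
  exact: continuous_measurable_fun.
- by move=> x _; rewrite lee_fin mulr_ge0// normal_pdf_ge0.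
apply: eq_integral => x; rewrite inE /= in_itv /= andbT => x0.
by rewrite ger0_norm// -EFinM; congr EFin; ring.
Qed.

Lemma integral_halfnormal : (\int[mu]_(z in @halfline R) (2 * phi z)%:E = 1)%E.
Proof.
have := @ge0_integral_normal_pdf_even (cst (1 : R)) (@cst_continuous R R 1) (fun=> ler01).
under eq_integral do rewrite mul1r; rewrite integral_normal_pdf => ->.
by apply: eq_integral => z _; rewrite mul1r.
Qed.

Lemma expectation_abs_normal (d : measure_display) (T : measurableType d)
    (P : probability T R) (Z : {RV P >-> R}) (g : R -> R) :
  (forall A : set R, measurable A -> distribution P Z A = normal_prob 0 1 A) ->
  continuous g ->
  ('E_P[fun w => (g `|Z w|)%R] =
   \int[mu]_(z in @halfline R) (g z * (2 * phi z))%:E)%E.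
Proof.
move=> Z_normal cg.
have ge0_case (h : R -> R) : continuous h -> (forall x, 0 <= h x) ->
    (\int[P]_w (h `|Z w|)%:E = \int[mu]_(z in @halfline R) (h z * (2 * phi z))%:E)%E.
  move=> ch h0.
  have mh : measurable_fun [set: measurableTypeR R] (fun x => (h `|x|)%:E).
    apply/measurable_EFinP; apply: continuous_measurable_fun => x.
    by apply: (@continuous_comp _ _ _ _ h); [exact: norm_continuous|exact: ch].
  (* [R] carries two displays of the same Borel sets: that of the random variable
     [Z] and that of the Lebesgue measure *)
  have mZ : measurable_fun [set: T] (Z : T -> measurableTypeR R).
    by move=> _ Y mY; exact: (measurable_funP Z).
  transitivity (\int[pushforward P (Z : T -> measurableTypeR R)]_x (h `|x|)%:E)%E.
    rewrite ge0_integral_pushforward//.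
    by move=> x _; rewrite lee_fin.
  rewrite [LHS](eq_measure_integral (normal_prob 0 1)); last first.
    by move=> A mA _; exact: Z_normal.
  rewrite ge0_integral_normal_prob//; last by move=> x; rewrite lee_fin.
  under eq_integral do rewrite -EFinM.
  exact: ge0_integral_normal_pdf_even.
rewrite unlock integral_funr_posneg [RHS]integral_funr_posneg.
have cpos (h : R -> R) : continuous h -> continuous (fun x => Num.max (h x) 0).
  move=> ch x; apply: (@continuous_max _ _ h (cst 0)); [exact: ch|exact: cst_continuous].
rewrite (ge0_case (fun x => Num.max (g x) 0)); last 2 first.
- exact: cpos.
- by move=> x; rewrite le_max lexx orbT.
rewrite (ge0_case (fun x => Num.max (- g x) 0)); last 2 first.
- by apply: cpos => x; apply: continuousN; exact: cg.
- by move=> x; rewrite le_max lexx orbT.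
have phi0 x : 0 <= 2 * phi x by rewrite mulr_ge0// normal_pdf_ge0.
by congr (_ - _)%E; apply: eq_integral => y _; rewrite maxr_pMl// ?mul0r ?mulNr.
Qed.

End normal.

(** * Dominated convergence on the rescaled grid *)

Section domination.
Context (R : realType).
Local Notation mu := (@lebesgue_measure R).
Local Notation halfline := (@halfline R).

Lemma integrable_expR_halfline (C r : R) : 0 < r ->
  mu.-integrable halfline (fun z => (C * expR (- (r * z)))%:E).
Proof.
move=> r0; apply: (@eq_integrable _ _ _ mu halfline _
  (fun z => (C / r)%:E * (exponential_pdf r z)%:E)%E) => [|z|].
- exact: measurable_itv.
- rewrite inE /halfline /= in_itv /= andbT => z0.
  by rewrite exponential_pdfE// -EFinM mulNr mulrA divfK ?gt_eqF.
apply: integrableZl; first exact: measurable_itv.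
apply: (@integrableS _ _ _ mu setT) => //; first exact: measurable_itv.
exact: integrable_exponential_pdf.
Qed.

(** The number of the cell of mesh [1 / sqrt (2 (n + 1))] that contains [z]. *)
Definition grid (n : nat) (z : R) : nat := Num.truncn (z * Num.sqrt (2 * n.+1%:R)).

Lemma sqrt2n_gt0 n : 0 < Num.sqrt (2 * n.+1%:R) :> R.
Proof. by rewrite sqrtr_gt0 mulr_gt0. Qed.

Lemma measurable_grid n k : measurable (halfline `&` grid n @^-1` [set k]).
Proof. exact: measurable_truncn_preimage (sqrt2n_gt0 n). Qed.

Lemma grid_ge n z : 0 <= z -> z - 1 <= (grid n z)%:R / rootn R n.
Proof.
move=> z0; have s0 := rootn_gt0 R n; rewrite /grid sqrtrM// -/(rootn R n).
set x := z * _; have x0 : 0 <= x by rewrite !mulr_ge0// ltW.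
have /andP[_ hi] := truncn_itv x0.
have s1 : 1 <= rootn R n by rewrite /rootn -[leLHS]sqrtr1 ler_sqrt// ler1n.
have r2 : 1 <= Num.sqrt 2 :> R by rewrite -[leLHS]sqrtr1 ler_sqrt// ler1n.
rewrite ler_pdivlMr//; apply: (@le_trans _ _ (x - 1)); last first.
  by rewrite lerBlDr natr1 ltW.
rewrite mulrBl mul1r /x mulrA lerB// ler_pM2r//.
by rewrite ler_peMr.
Qed.

Lemma cvg_real_bounded (k : nat -> R) (l : R) : k n @[n --> \oo] --> l ->
  exists B, forall n, `|k n| <= B.
Proof.
move=> kl; have /cvg_seq_bounded/pinfty_ex_gt0[B _ kB] : cvgn k by apply/cvg_ex; exists l.
by exists B => n; exact: kB.
Qed.

Section dominated.
Variables (a u : nat -> nat -> R) (U : R -> R) (k : nat -> R) (l C : R).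
Hypothesis dec : forall n, gaussian_decay n.+1 (a n).
Hypothesis u_le : forall n m, `|u n m| <= C * expR (m%:R / rootn R n / 8).
Hypothesis u_cvg : forall z, 0 <= z -> u n (grid n z) @[n --> \oo] --> U z.
Hypothesis mU : measurable_fun halfline U.
Hypothesis k_cvg : k n @[n --> \oo] --> l.

(** The product is dominated by [exp (1 / 2 - q / 4)] and [u] by [exp (q / 8)],
where [q = m / sqrt (n + 1) >= z - 1] in the cell of [z]; what remains is the
integrable function [exp (- z / 8)] up to a constant. *)
Lemma dominated_riemann_sum :
  mu.-integrable halfline (fun z => (U z * (l * expR (- (z ^+ 2 / 2))))%:E) /\
  (\int[mu]_(z in halfline)
     (u n (grid n z) * (k n * \prod_(i < grid n z) (1 - a n i)))%:E)%E @[n --> \oo] -->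
  (\int[mu]_(z in halfline) (U z * (l * expR (- (z ^+ 2 / 2))))%:E)%E.
Proof.
have [B kB] : exists B, forall n, `|k n| <= B.
  exact: cvg_real_bounded k_cvg.
have B0 : 0 <= B by apply: le_trans (kB 0%N).
have C0 : 0 <= C.
  have := le_trans (normr_ge0 _) (u_le 0%N 0%N).
  by rewrite mul0r mul0r expR0 mulr1.
pose g z : \bar R := (C * B * expR 1 * expR (- (8^-1 * z)))%:E.
have [//||||//||] := @dominated_convergence _ _ _ mu halfline _
  (fun n z => (u n (grid n z) * (k n * \prod_(i < grid n z) (1 - a n i)))%:E)
  (fun z => (U z * (l * expR (- (z ^+ 2 / 2))))%:E) g; last by move=> ? _ ?; split.
- exact: measurable_itv.
- move=> n; apply: (measurable_fun_nat_valued (measurable_grid n)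
    (fun m => (u n m * (k n * \prod_(i < m) (1 - a n i)))%:E)).
- apply/measurable_EFinP; apply: measurable_funM => //; apply: measurable_funTS.
  apply: measurable_funM => //; apply: continuous_measurable_fun => z.
  apply: continuous_comp; last exact: continuous_expR.
  by apply: continuousN; apply: cvgM; [exact: exprn_continuous|exact: cvg_cst].
- apply/aeW => z; rewrite /halfline /= in_itv /= andbT => z0.
  apply: cvg_EFin; first exact: nearW.
  apply: cvgM; first exact: u_cvg.
  apply: cvgM => //=.
  rewrite (_ : z ^+ 2 / 2 = (Num.sqrt 2 * z) ^+ 2 / 4); last first.
    by rewrite exprMn sqr_sqrtr//; field.
  apply: gaussian_decay_cvg => //; exact: truncn_scaled_cvg.
- by apply: integrable_expR_halfline; rewrite invr_gt0.
- apply/aeW => z n; rewrite /halfline /= in_itv /= andbT => z0.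
  set m := grid n z; set q : R := m%:R / rootn R n.
  have qz : z - 1 <= q := grid_ge n z0.
  have prod_le : `|\prod_(i < m) (1 - a n i)| <= expR (2^-1 - q / 4).
    rewrite ger0_norm; first exact: gaussian_decay_dominated.
    by apply: prodr_ge0 => i _; rewrite subr_ge0; have [] := dec n i.
  rewrite /g lee_fin !normrM.
  apply: (@le_trans _ _ (C * expR (q / 8) * (B * expR (2^-1 - q / 4)))).
    by apply: ler_pM; rewrite ?mulr_ge0 ?u_le//; apply: ler_pM.
  have -> : C * expR (q / 8) * (B * expR (2^-1 - q / 4)) =
      C * B * expR (2^-1 - q / 8).
    by rewrite mulrACA -expRD; congr (_ * expR _); field.
  rewrite -[leRHS]mulrA -expRD ler_wpM2l ?mulr_ge0// ler_expR.
  by lra.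
Qed.
End dominated.
End domination.

(** * Limits of expectations of natural-valued variables *)

Section nat_valued_limit.
Context (R : realType) (d : measure_display) (T : measurableType d).
Variables (P : probability T R) (M : nat -> T -> nat) (p a : nat -> nat -> R).
Local Notation mu := (@lebesgue_measure R).
Local Notation halfline := (@halfline R).
Local Notation phi := (@normal_pdf R 0 1).
Hypothesis mM : forall n k, measurable (M n @^-1` [set k]).
Hypothesis pE : forall n k, P (M n @^-1` [set k]) = (p n k)%:E.
Hypothesis pS : forall n k, p n k.+1 = p n k * (1 - a n k).
Hypothesis dec : forall n, gaussian_decay n.+1 (a n).

(** The factor between the weight of a cell number and the product of the ratios,
   including the inverse of the mesh. *)
Let scale n : R := p n 0%N * Num.sqrt (2 * n.+1%:R).

Let p_prod n k : p n k = p n 0%N * \prod_(i < k) (1 - a n i).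
Proof.
elim: k => [|k IH]; first by rewrite big_ord0 mulr1.
by rewrite pS IH big_ord_recr /= mulrA.
Qed.

Let integral_index n (f : nat -> R) :
  (\int[P]_w (f (M n w))%:E =
   \int[mu]_(z in halfline)
     (f (grid n z) * (scale n * \prod_(i < grid n z) (1 - a n i)))%:E)%E.
Proof.
have s0 : 0 < Num.sqrt (2 * n.+1%:R) :> R by exact: sqrt2n_gt0.
rewrite (@integral_nat_valued_transfer _ _ _ _ _ P mu setT halfline (M n) (grid n)
   (fun k => p n k * Num.sqrt (2 * n.+1%:R)) f).
- by apply: eq_integral => z _; rewrite p_prod /scale; congr EFin; ring.
- by move=> k; rewrite setTI; exact: mM.
- exact: measurable_grid.
- by move=> k; apply: mulr_ge0; [rewrite -lee_fin -pE measure_ge0|exact: ltW].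
- move=> k; have /= -> := lebesgue_truncn_preimage k s0.
  by rewrite setTI -EFinM mulfK ?gt_eqF//; exact: pE.
Qed.

Let scale_ge0 n : 0 <= scale n.
Proof. by apply: mulr_ge0 => //; rewrite -lee_fin -pE measure_ge0. Qed.

(** The total mass is 1 for each [n], so [scale n] is the inverse of the integral
of the step function; that integral converges to the integral of
[exp (- z ^ 2 / 2)] over the half-line. *)
Let scale_cvg : scale n @[n --> \oo] --> 2 * normal_peak 1.
Proof.
pose I n : \bar R := (\int[mu]_(z in halfline) (\prod_(i < grid n z) (1 - a n i))%:E)%E.
pose J : \bar R := (\int[mu]_(z in halfline) (expR (- (z ^+ 2 / 2)))%:E)%E.
have peak0 : 0 < normal_peak 1 :> R by rewrite normal_peak_gt0// oner_neq0.
have prod0 n k : 0 <= \prod_(i < k) (1 - a n i).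
  by apply: prodr_ge0 => i _; rewrite subr_ge0; have [] := dec n i.
have mh : measurable (halfline : set (measurableTypeR R)) by exact: measurable_itv.
have scaleI n : ((scale n)%:E * I n = 1)%E.
  have P1 : (\int[P]_w (cst (1 : R) (M n w))%:E = 1)%E.
    transitivity (1%:E * P setT)%E; first exact: (integral_cst P measurableT 1%:E).
    by rewrite probability_setT mule1.
  rewrite -P1 integral_index -ge0_integralZl_EFin//.
  - by apply: eq_integral => z _; rewrite /= mul1r EFinM.
  - by move=> z _; rewrite lee_fin.
  - exact: (measurable_fun_nat_valued (measurable_grid n)
      (fun k => (\prod_(i < k) (1 - a n i))%:E)).
have peakJ : J = ((2 * normal_peak 1)^-1)%:E.
  have := integral_halfnormal R.
  under eq_integral do rewrite normal_pdf01E mulrA EFinM.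
  rewrite ge0_integralZl_EFin//.
  - have c0 : (0 < (2 * normal_peak 1 : R)%:E)%E by rewrite lte_fin mulr_gt0.
    rewrite -/J; case: J => [r /= [cr]||].
    + congr EFin; apply: (mulfI (_ : 2 * normal_peak 1 != 0));
        by rewrite ?cr ?divff// gt_eqF// mulr_gt0.
    + by rewrite gt0_muley.
    + by rewrite gt0_muleNy.
  - apply/measurable_EFinP; apply: measurable_funTS; apply: continuous_measurable_fun => z.
    apply: continuous_comp; last exact: continuous_expR.
    by apply: continuousN; apply: cvgM; [exact: exprn_continuous|exact: cvg_cst].
  - by rewrite mulr_ge0// ltW.
have IJ : I n @[n --> \oo] --> J.
  have one_le (n m : nat) : `|1 : R| <= 1 * expR (m%:R / rootn R n / 8).
    by rewrite normr1 mul1r -expR0 ler_expR !divr_ge0// ltW// rootn_gt0.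
  have one_cvg (z : R) : 0 <= z -> (1 : R) @[_ --> \oo] --> cst (1 : R) z.
    by move=> _; exact: cvg_cst.
  have [_] := dominated_riemann_sum (u := fun _ _ => 1) dec one_le one_cvg
    (@measurable_cst _ _ _ _ _ (1 : R)) (@cvg_cst _ (1 : R) nat \oo _).
  rewrite /cst /=; under eq_fun do under eq_integral do rewrite !mul1r.
  by under [X in _ --> X]eq_integral do rewrite !mul1r.
have : fine (I n) @[n --> \oo] --> (2 * normal_peak 1)^-1.
  by move: IJ; rewrite peakJ => /fine_cvgP[].
move=> /(cvgV (_ : (2 * normal_peak 1)^-1 != 0)); rewrite invrK invr_eq0 => VI.
rewrite (_ : scale = fun n => (fine (I n))^-1); last first.
  apply/funext => n; have := scaleI n; have := scale_ge0 n;
  rewrite le_eqVlt => /predU1P[<-|c0].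
    by rewrite mul0e => -[/eqP]; rewrite eq_sym oner_eq0.
  case: (I n) => [r [cr]||].
  - have r0 : r != 0 by apply: contra_eq_neq cr => ->; rewrite mulr0 eq_sym oner_eq0.
    by rewrite /= -[LHS](mulfK r0) cr mul1r.
  - by rewrite gt0_muley.
  - by rewrite gt0_muleNy.
by apply: VI; rewrite gt_eqF// mulr_gt0.
Qed.

Lemma nat_valued_expectation_cvg (u : nat -> nat -> R) (U : R -> R) (C : R) :
  (forall n m, `|u n m| <= C * expR (m%:R / rootn R n / 8)) ->
  (forall z, 0 <= z -> u n (grid n z) @[n --> \oo] --> U z) ->
  measurable_fun halfline U ->
  mu.-integrable halfline (fun z => (U z * (2 * phi z))%:E) /\
  (\int[P]_w (u n (M n w))%:E)%E @[n --> \oo] -->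
  (\int[mu]_(z in halfline) (U z * (2 * phi z))%:E)%E.
Proof.
move=> u_le u_cvg mU.
have [intU] := dominated_riemann_sum dec u_le u_cvg mU scale_cvg.
have UE : (fun z => (U z * (2 * normal_peak 1 * expR (- (z ^+ 2 / 2))))%:E) =
  (fun z => (U z * (2 * phi z))%:E).
  by apply/funext => z; rewrite normal_pdf01E; congr EFin; ring.
move: intU; rewrite UE => intU; under eq_fun do rewrite -integral_index.
by [].
Qed.
End nat_valued_limit.

(** * Functions of subexponential growth *)

Section subexponential.
Context (R : realType).
Implicit Types (f : R -> R).

(** The rate [1 / 8] is half of the [1 / 4] in [gaussian_decay_dominated], which
leaves an integrable bound. *)
Definition subexponential f :=
  continuous f /\ exists C, forall x, `|f x| <= C * expR (`|x| / 8).

Lemma bounded_subexponential f : continuous f -> bounded_fun f -> subexponential f.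
Proof.
move=> cf /pinfty_ex_gt0[B B0 fB]; split=> //; exists B => x.
by apply: le_trans (fB x I) _; rewrite ler_peMr ?(ltW B0)// -expR0 ler_expR divr_ge0.
Qed.

(** One term of the exponential series. *)
Lemma exprn_le_expR (k : nat) (x : R) : 0 <= x ->
  x ^+ k <= (k`!%:R * 8 ^+ k) * expR (x / 8).
Proof.
move=> x0; have x8 : 0 <= x / 8 by rewrite divr_ge0.
case: k => [|k].
  by rewrite fact0 !expr0 mulr1 mul1r -[X in X <= _]expR0 ler_expR.
have := expR_ge1Dxn k x8; rewrite expr_div_n => h.
have f0 : 0 < (k.+1)`!%:R :> R by rewrite ltr0n fact_gt0.
have e0 : 0 < 8 ^+ k.+1 :> R by rewrite exprn_gt0.
rewrite mulrC -ler_pdivrMr ?mulr_gt0// invfM mulrA [X in X <= _]mulrAC.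
by apply: le_trans h; rewrite lerDr.
Qed.

Lemma exprn_subexponential (k : nat) : subexponential (fun x => x ^+ k).
Proof.
split; first exact: exprn_continuous.
by exists (k`!%:R * 8 ^+ k) => x; rewrite normrX exprn_le_expR.
Qed.

Lemma normM_subexponential (k : R) : subexponential (fun x => `|x| * k).
Proof.
split.
  by move=> x; apply: cvgM; [exact: norm_continuous|exact: cvg_cst].
exists (8 * `|k|) => x; rewrite normrM normr_id mulrAC ler_wpM2r//.
by have := exprn_le_expR 1 (normr_ge0 x); rewrite !expr1 mul1r.
Qed.

Lemma powR_norm_continuous (r : R) : 0 < r -> continuous (fun x : R => `|x| `^ r).
Proof.
move=> r0 x; have [->|x0] := eqVneq x 0.
  apply/cvgrPdist_lt => e e0; rewrite normr0 powR0 ?gt_eqF//.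
  have : \forall t \near (0 : R), `|t| < e `^ r^-1 by exact: nbhs0_lt (powR_gt0 _ e0).
  apply: filterS => t te; rewrite sub0r normrN ger0_norm ?powR_ge0//.
  rewrite [ltRHS](_ : e = (e `^ r^-1) `^ r).
    by rewrite gt0_ltr_powR ?nnegrE ?powR_ge0.
  by rewrite -powRrM mulVf ?gt_eqF// powRr1// ltW.
have nx : 0 < `|x| by rewrite normr_gt0.
apply: (@continuous_comp _ _ _ (fun x : R => `|x|) (fun y => y `^ r)).
  exact: norm_continuous.
apply: differentiable_continuous; apply/derivable1_diffP.
by apply: derivable_powR; rewrite in_itv /= nx.
Qed.

(** For [`|x| >= 1] the real power is at most the next integer power; for
[`|x| <= 1] it is at most 1. *)
Lemma powR_norm_subexponential (r : R) : 0 < r -> subexponential (fun x => `|x| `^ r).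
Proof.
move=> r0; split; first exact: powR_norm_continuous.
set k := (Num.truncn r).+1; exists (1 + k`!%:R * 8 ^+ k) => x.
have rk : r <= k%:R by rewrite ltW// truncnS_gt.
rewrite ger0_norm ?powR_ge0// mulrDl mul1r.
have e1 : 1 <= expR (`|x| / 8) by rewrite -expR0 ler_expR divr_ge0.
have := @exprn_le_expR k `|x| (normr_ge0 _).
have [x1 xk|x1] := leP 1 `|x|.
  apply: le_trans (_ : `|x| `^ k%:R <= _); first exact: ler_powR.
  by rewrite powR_mulrn//; lra.
move=> xk; have : `|x| `^ r <= 1.
  have <- : 1 `^ r = 1 :> R by rewrite powR1.
  by apply: ge0_ler_powR; rewrite ?nnegrE ?normr_ge0 ?ler01 ?(ltW r0) ?(ltW x1).
have := exprn_ge0 k (normr_ge0 x); lra.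
Qed.
End subexponential.

(** * Convergence of moments *)

Section limit_law.
Context (R : realType) (d d' : measure_display).
Context (T : measurableType d) (T' : measurableType d').
Variables (P : probability T R) (P' : probability T' R) (Z : {RV P' >-> R}).
Variables (M : nat -> T -> nat) (p a : nat -> nat -> R).
Local Notation mu := (@lebesgue_measure R).
Local Notation halfline := (@halfline R).
Local Notation phi := (@normal_pdf R 0 1).
Hypothesis Z_normal : forall A : set R, measurable A ->
  distribution P' Z A = normal_prob 0 1 A.
Hypothesis mM : forall n k, measurable (M n @^-1` [set k]).
Hypothesis pE : forall n k, P (M n @^-1` [set k]) = (p n k)%:E.
Hypothesis pS : forall n k, p n k.+1 = p n k * (1 - a n k).
Hypothesis dec : forall n, gaussian_decay n.+1 (a n).
(** [X n] is the waiting time with parameter [n.+1]: it lies on the side [sg] of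
    [2 (n + 1)], at distance [M n + delta]. The relation is only almost sure since
    [X2] is 0 when the waiting time is infinite. *)
Variables (sg delta : R) (X : nat -> T -> R).
Hypothesis sg1 : `|sg| = 1.
Hypothesis mX : forall n, measurable_fun [set: T] (X n).
Hypothesis XM : forall n, {ae P, forall w,
  X n w = 2 * n.+1%:R + sg * ((M n w)%:R + delta)}.

Let Y n w : R := (X n w - 2 * n.+1%:R) / rootn R n.
Let Y' w : R := sg * Num.sqrt 2 * `|Z w|.

Let y n m : R := sg * ((m%:R + delta) / rootn R n).

Let y_le n m : `|y n m| <= m%:R / rootn R n + `|delta|.
Proof.
rewrite normrM sg1 mul1r normrM normfV (gtr0_norm (rootn_gt0 R n)).
have s1 : 1 <= rootn R n by rewrite /rootn -[leLHS]sqrtr1 ler_sqrt// ler1n.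
apply: (@le_trans _ _ ((m%:R + `|delta|) / rootn R n)).
  rewrite ler_pM2r ?invr_gt0 ?rootn_gt0//.
  by apply: le_trans (ler_normD _ _) _; rewrite ger0_norm.
rewrite mulrDl lerD2l ler_pdivrMr ?rootn_gt0//.
by rewrite ler_peMr.
Qed.

Let y_cvg z : 0 <= z -> y n (grid n z) @[n --> \oo] --> sg * Num.sqrt 2 * z.
Proof.
move=> z0; rewrite -mulrA; apply: cvgM; first exact: cvg_cst.
rewrite (_ : (fun n => _) = fun n =>
    (grid n z)%:R / rootn R n + delta * (rootn R n)^-1); last first.
  by apply/funext => n; rewrite mulrDl.
rewrite (_ : Num.sqrt 2 * z = Num.sqrt 2 * z + delta * 0); last by rewrite mulr0 addr0.
apply: cvgD; first exact: truncn_scaled_cvg.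
by apply: cvgM; [exact: cvg_cst|exact: cvg_rootnV].
Qed.

Let expectation_index n (c : R) (f : R -> R) : continuous f ->
  ('E_P[fun w => f (Y n w - c)%R] = \int[P]_w (f (y n (M n w) - c)%R)%:E)%E.
Proof.
move=> cf; rewrite unlock; apply: ae_eq_integral => //.
- apply/measurable_EFinP; apply: measurableT_comp.
    exact: continuous_measurable_fun.
  by apply: measurable_funB => //; apply: measurable_funM => //; exact: measurable_funB.
- apply: (measurable_fun_nat_valued (X := M n) (D := setT) _ (fun m => (f (y n m - c))%:E)).
  by move=> k; rewrite setTI; exact: mM.
- apply: filterS (XM n) => w XMw _; congr (f (_ - _))%:E.
  by rewrite /Y /y XMw addrAC subrr add0r mulrA.
Qed.

(** Shifts that converge keep the subexponential bound uniform in [n] and pass to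
the limit by continuity of [f]. The limit is finite, which is what makes the
waiting times eventually integrable. *)
Lemma shifted_expectation_cvg (f : R -> R) (c : nat -> R) (l : R) :
  subexponential f -> c n @[n --> \oo] --> l ->
  'E_P'[fun w => f (Y' w - l)%R]%E \is a fin_num /\
  'E_P[fun w => f (Y n w - c n)%R]%E @[n --> \oo] --> 'E_P'[fun w => f (Y' w - l)%R]%E.
Proof.
move=> [cf [C fC]] cl; have [B cB] := cvg_real_bounded cl.
have C0 : 0 <= C.
  have := le_trans (normr_ge0 _) (fC 0).
  by rewrite normr0 mul0r expR0 mulr1.
pose U z := f (sg * Num.sqrt 2 * z - l).
have cU : continuous U.
  move=> z.
  apply: (@continuous_comp _ _ _ (fun z => sg * Num.sqrt 2 * z - l) f); last exact: cf.
  by apply: cvgB; [apply: cvgM; [exact: cvg_cst|exact: cvg_id]|exact: cvg_cst].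
have u_le n m : `|f (y n m - c n)| <=
    C * expR ((`|delta| + B) / 8) * expR (m%:R / rootn R n / 8).
  apply: le_trans (fC _) _; rewrite -mulrA -expRD ler_wpM2l// ler_expR.
  rewrite -mulrDl ler_pM2r// ?invr_gt0//.
  by have := ler_normB (y n m) (c n); have := y_le n m; have := cB n; lra.
have u_cvg z : 0 <= z -> f (y n (grid n z) - c n) @[n --> \oo] --> U z.
  move=> z0; apply: continuous_cvg; first exact: cf.
  by apply: cvgB => //; exact: y_cvg.
have mU : measurable_fun halfline U.
  by apply: measurable_funTS; exact: continuous_measurable_fun.
have [intU lim] := nat_valued_expectation_cvg mM pE pS dec
  (u := fun n m => f (y n m - c n)) u_le u_cvg mU.
rewrite (@expectation_abs_normal _ _ _ _ _ U Z_normal cU).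
rewrite (_ : (fun n => _) =
    fun n => (\int[P]_w (f (y n (M n w) - c n)%R)%:E)%E); last first.
  by apply/funext => n; exact: expectation_index.
split => //; apply: integrable_fin_num => //; exact: measurable_itv.
Qed.

Lemma shifted_all_moments_cvg (W : nat -> T -> R) (V : T' -> R) (c : nat -> R) (l : R) :
  (forall n w, W n.+1 w = Y n w - c n) -> (forall w, V w = Y' w - l) ->
  c n @[n --> \oo] --> l -> cvg_distribution_with_all_moments P P' W V.
Proof.
move=> WY VY cl.
have key f : subexponential f ->
    'E_P[fun w => f (W n w)]%E @[n --> \oo] --> 'E_P'[fun w => f (V w)]%E.
  move=> sf; have [_ lim] := shifted_expectation_cvg sf cl.
  rewrite -cvg_shiftS /=.
  rewrite (_ : (fun n => _) = (fun n => 'E_P[fun w => f (Y n w - c n)%R]%E)); last first.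
    by apply/funext => n; congr expectation; apply/funext => w; rewrite WY.
  rewrite (_ : (fun w => f (V w)) = (fun w => f (Y' w - l)%R)) //.
  by apply/funext => w; rewrite VY.
split.
- by move=> f cf bf; exact: key (bounded_subexponential cf bf).
- by move=> k _; exact: key (exprn_subexponential R k).
- by move=> r r0; exact: key (powR_norm_subexponential r0).
Qed.

Let absZ w : R := `|Z w|.

(** Finiteness of the limit for the function [`|x| / sqrt 2], which maps [Y'] to
[absZ]. *)
Let integrable_absZ : P'.-integrable setT (EFin \o absZ).
Proof.
have mabs : measurable_fun setT absZ.
  by apply: measurableT_comp => //; exact: measurable_normr.
apply/integrableP; split; first exact/measurable_EFinP.
have s2 : Num.sqrt 2 != 0 :> R by rewrite gt_eqF// sqrtr_gt0.
have [+ _] := shifted_expectation_cvg (normM_subexponential (Num.sqrt 2)^-1)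
  (@cvg_cst _ (0 : R) nat \oo _).
rewrite unlock fin_numElt => /andP[_]; congr (_ < _)%E; apply: eq_integral => w _.
rewrite /Y' /absZ /= subr0 !normrM sg1 mul1r normr_id.
by rewrite (ger0_norm (sqrtr_ge0 _)) mulrAC divff// mul1r.
Qed.

(** Convergence of [E `|Y n|] to a finite limit makes [Y n] integrable for all
large [n], so that the expectation of [X n] can be computed by linearity. *)
Lemma mean_cvg :
  (mean P (X n) - 2 * n.+1%:R) / rootn R n @[n --> \oo] --> sg * Num.sqrt 2 * mean P' absZ.
Proof.
have id_sub : subexponential (@id R) by have := exprn_subexponential R 1.
have [_ EY] := shifted_expectation_cvg id_sub (@cvg_cst _ (0 : R) nat \oo _).
have [absfin EaY] := shifted_expectation_cvg (normM_subexponential 1)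
  (@cvg_cst _ (0 : R) nat \oo _).
have meanY' : 'E_P'[fun w => (Y' w - 0)%R]%E = (sg * Num.sqrt 2 * mean P' absZ)%:E.
  have absZ1 : absZ \in Lfun P' 1 by apply/Lfun1_integrable; exact: integrable_absZ.
  rewrite (_ : (fun w => _) = (sg * Num.sqrt 2) \o* absZ); last first.
    by apply/funext => w; rewrite subr0 /= mulrC.
  by rewrite expectationZl// /mean [RHS]EFinM fineK// expectation_fin_num.
have intY : \forall n \near \oo, P.-integrable setT (EFin \o Y n).
  move: EaY; rewrite -(fineK absfin) => /fine_cvgP[+ _]; apply: filterS => n.
  rewrite unlock fin_numElt => /andP[_ fin]; apply/integrableP; split.
    apply/measurable_EFinP; apply: measurable_funM => //.
    exact: measurable_funB.
  apply: le_lt_trans fin; rewrite le_eqVlt; apply/orP; left; apply/eqP.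
  by apply: eq_integral => w _; rewrite /= subr0 mulr1.
have : fine 'E_P[fun w => (Y n w - 0)%R] @[n --> \oo] --> sg * Num.sqrt 2 * mean P' absZ.
  by move: EY; rewrite meanY' => /fine_cvgP[].
apply: cvg_trans; apply: near_eq_cvg; apply: filterS intY => n intYn.
have Yn1 : Y n \in Lfun P 1 by apply/Lfun1_integrable.
have s0 : rootn R n != 0 by rewrite gt_eqF// rootn_gt0.
rewrite /mean (_ : X n = (rootn R n \o* Y n) \+ cst (2 * n.+1%:R)); last first.
  by apply/funext => w; rewrite /= /Y divfK// subrK.
rewrite (_ : (fun w => (Y n w - 0)%R) = Y n); last first.
  by apply/funext => w; rewrite subr0.
rewrite expectationD; last 2 first.
- have /(_ (lexx _)) := rpredZ (rootn R n) Yn1.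
  have -> // : rootn R n \o* Y n = rootn R n *: Y n.
  by apply/funext => w; rewrite /= mulrC.
- exact: Lfun_cst.
rewrite expectationZl// (expectation_cst P).
have /EFin_fin_numP[r ->] := expectation_fin_num Yn1.
by rewrite /= addrK mulrC mulKf.
Qed.

Lemma normalized_all_moments_cvg (x : nat -> T -> R) :
  (forall n, x n.+1 = X n) ->
  cvg_distribution_with_all_moments P P'
    (fun n w => (x n w - 2 * n%:R) / Num.sqrt n%:R)
    (fun w => sg * Num.sqrt 2 * `|Z w|) /\
  cvg_distribution_with_all_moments P P'
    (fun n w => (x n w - mean P (x n)) / Num.sqrt n%:R)
    (fun w => sg * Num.sqrt 2 * (`|Z w| - mean P' (fun w => `|Z w|))).
Proof.
move=> xX; split.
  apply: (@shifted_all_moments_cvg _ _ (cst 0) 0); last exact: cvg_cst.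
  - by move=> n w; rewrite xX subr0.
  - by move=> w; rewrite subr0.
apply: (shifted_all_moments_cvg _ _ mean_cvg).
- by move=> n w; rewrite xX /Y /rootn -mulrBl; congr (_ * _); ring.
- by move=> w; rewrite mulrBr.
Qed.

End limit_law.

(** * The fair coin *)

Section coin_decay.
Context (R : realType).

Definition earliness_decay (n m : nat) : R := if (m < n)%N then m%:R / (n.*2 - m)%:R else 1.
Definition lateness_decay (n m : nat) : R := m.+2%:R / (2 * (n + m.+2)%:R).

(** Weights beyond [n] vanish, which the relative decrease 1 at [n] expresses. *)
Lemma gaussian_decay_earliness n : gaussian_decay n.+1 (earliness_decay n).
Proof.
move=> i; rewrite /earliness_decay; case: ltnP => ni; split.
- rewrite ler_wpM2l// -natrM lef_pV2 ?posrE ?ltr0n ?muln_gt0//; last by lia.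
  by rewrite ler_nat; lia.
- by rewrite ler_pdivrMr ?mul1r ?ltr0n ?ler_nat; lia.
- move=> _; rewrite doubleS !subSS; apply: ler_pM => //; rewrite ?invr_ge0 ?ler_nat//.
  by lia.
- by rewrite ler_pdivrMr ?mul1r -?natrM ?ltr0n ?muln_gt0// ler_nat; lia.
- by [].
- by move=> i2n; rewrite ler_pdivlMr ?mul1r ?ltr0n ?ler_nat; lia.
Qed.

Lemma gaussian_decay_lateness n : gaussian_decay n.+1 (lateness_decay n).
Proof.
move=> i; rewrite /lateness_decay addSnnS; split.
- by apply: ler_pM => //; rewrite ler_nat; lia.
- by rewrite -natrM ler_pdivrMr ?mul1r ?ltr0n ?ler_nat; lia.
- move=> i2n; rewrite -natrM ler_wpM2l// lef_pV2 ?posrE ?ltr0n ?ler_nat; lia.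
Qed.
End coin_decay.

Theorem theorem4p7 (R : realType) (d d' : measure_display)
    (T : measurableType d) (T' : measurableType d')
    (P : probability T R) (P' : probability T' R)
    (toss : nat -> {RV P >-> bool}) (Z : {RV P' >-> R})
    (toss_fair : fair_coin_tosses toss)
    (Z_normal : forall A : set R, measurable A ->
      distribution P' Z A = normal_prob 0 1 A) :
  let x1 (n : nat) (w : T) : R := (X1 toss n w)%:R in
  let x2 (n : nat) (w : T) : R := (X2 toss n w)%:R in
  let absZ (w : T') : R := `|Z w| in
  [/\ cvg_distribution_with_all_moments P P'
        (fun n w => (x1 n w - 2 * n%:R) / Num.sqrt n%:R)
        (fun w => - Num.sqrt 2 * absZ w),
      cvg_distribution_with_all_moments P P'
        (fun n w => (x1 n w - mean P (x1 n)) / Num.sqrt n%:R)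
        (fun w => - Num.sqrt 2 * (absZ w - mean P' absZ)),
      cvg_distribution_with_all_moments P P'
        (fun n w => (x2 n w - 2 * n%:R) / Num.sqrt n%:R)
        (fun w => Num.sqrt 2 * absZ w)
    & cvg_distribution_with_all_moments P P'
        (fun n w => (x2 n w - mean P (x2 n)) / Num.sqrt n%:R)
        (fun w => Num.sqrt 2 * (absZ w - mean P' absZ))].
Proof.
move=> x1 x2 absZ.
have mx1 n : measurable_fun [set: T] (x1 n.+1).
  rewrite (_ : x1 n.+1 = (fun m => (n.*2.+1 - m)%:R) \o earliness toss n).
    apply: measurable_fun_nat_valued => k; rewrite setTI; exact: measurable_earliness.
  by apply/funext => w; rewrite /x1 X1_earliness.
have x1E n : {ae P, forall w,
    x1 n.+1 w = 2 * n.+1%:R + -1 * ((earliness toss n w)%:R + 1)}.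
  apply/aeW => w; have /andP[_ Xn] := X1_bounds toss n w.
  rewrite /x1 X1_earliness natrB ?leq_subr// -mul2n -!natr1 natrM; ring.
have mx2 n : measurable_fun [set: T] (x2 n.+1).
  apply: (measurable_fun_nat_valued (D := setT) _ (fun k => k%:R : R)) => k.
  by rewrite setTI; exact: measurable_X2_preimage.
have x2E n : {ae P, forall w,
    x2 n.+1 w = 2 * n.+1%:R + 1 * ((lateness toss n w)%:R + 0)}.
  exists [set w | X2 toss n.+1 w = 0%N]; split.
  - exact: measurable_X2_preimage0.
  - exact: prob_X2_preimage0.
  - move=> w /= nE; apply: contrapT => /X2_lateness X2E; apply: nE.
    by rewrite /x2 X2E natrD mul1r addr0 -doubleS -mul2n natrM.
have [lim1 lim1c] := normalized_all_moments_cvg Z_normal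
  (measurable_earliness toss) (prob_earliness toss_fair)
  (@earliness_pmfS R) (@gaussian_decay_earliness R)
  (normrN1 R) mx1 x1E (x := x1) (fun=> erefl).
have [lim2 lim2c] := normalized_all_moments_cvg Z_normal
  (measurable_lateness toss) (prob_lateness toss_fair)
  (@lateness_pmfS R) (@gaussian_decay_lateness R)
  (normr1 R) mx2 x2E (x := x2) (fun=> erefl).
by rewrite !mulN1r in lim1 lim1c; rewrite !mul1r in lim2 lim2c; split.
Qed.
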